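(* If $\psi$ is a Boolean combination of formulas of the form $L_s\psi'$ (with arbitrary formulas $\psi'$ of $\mathcal{L}$ and indices $s\in\mathbb{Q}\cap[0,1]$), then for every rational $r$ with $0<r\le1$ and every formula $\phi$ of $\mathcal{L}$, the formula $(L_r\phi\vee\psi)\leftrightarrow L_r(\phi\vee\psi)$ is a theorem of $\Sigma_H$.
   Context: Language $\mathcal{L}$: formulas are given by $\phi ::= p \mid \neg\phi \mid \phi_1\wedge\phi_2 \mid L_r\phi$, with $p$ from a countably infinite set of propositional letters and $r\in\mathbb{Q}\cap[0,1]$. A logic is a set of formulas containing all propositional tautologies and closed under modus ponens and uniform substitution. $\Sigma_H$ is the smallest logic containing (A1) $L_0\phi$; (A2) $L_r\top$; (A3) $L_r(\phi\wedge\psi)\wedge L_t(\phi\wedge\neg\psi)\to L_{r+t}\phi$ for $r+t\le 1$; (A4) $\neg L_r(\phi\wedge\psi)\wedge\neg L_s(\phi\wedge\neg\psi)\to\neg L_{r+s}\phi$ for $r+s\le1$; (A5) $L_r\phi\to\neg L_s\neg\phi$ for $r+s>1$; $(4_p)$ $L_r\phi\to L_1L_r\phi$; $(5_p)$ $\neg L_r\phi\to L_1\neg L_r\phi$; and closed under (DIS): from $\phi\leftrightarrow\psi$ infer $L_r\phi\leftrightarrow L_r\psi$; and (ARCH): if $\gamma\to L_s\phi$ is a theorem for all $s<r$, then $\gamma\to L_r\phi$ is a theorem. All indices are rationals in $[0,1]$. *)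

(* Defs.v *)
From mathcomp Require Import all_boot all_order all_algebra.
Set Implicit Arguments.
Unset Strict Implicit.
Unset Printing Implicit Defensive.
Import Order.TTheory GRing.Theory Num.Theory.
Local Open Scope ring_scope.

Definition idx := {r : rat | 0 <= r <= 1}.

Definition idx0 : idx := exist _ (0 : rat) isT.
Definition idx1 : idx := exist _ (1 : rat) isT.

Inductive formula : Type :=
| Var of nat
| Neg of formula
| And of formula & formula
| L of idx & formula.

Definition Or (phi psi : formula) : formula := Neg (And (Neg phi) (Neg psi)).
Definition Imp (phi psi : formula) : formula := Neg (And phi (Neg psi)).
Definition Iff (phi psi : formula) : formula := And (Imp phi psi) (Imp psi phi).
Definition Top : formula := Or (Var 0) (Neg (Var 0)).

Fixpoint subst (sigma : nat -> formula) (phi : formula) : formula :=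
  match phi with
  | Var p => sigma p
  | Neg phi1 => Neg (subst sigma phi1)
  | And phi1 phi2 => And (subst sigma phi1) (subst sigma phi2)
  | L r phi1 => L r (subst sigma phi1)
  end.

(* Formulas [L r phi] are propositional atoms here: [w] assigns them arbitrary
   truth values, so a tautology may contain modalities. *)
Fixpoint prop_eval (v : nat -> bool) (w : idx -> formula -> bool)
    (phi : formula) : bool :=
  match phi with
  | Var p => v p
  | Neg phi1 => ~~ prop_eval v w phi1
  | And phi1 phi2 => prop_eval v w phi1 && prop_eval v w phi2
  | L r phi1 => w r phi1
  end.

Definition tautology (phi : formula) : Prop :=
  forall (v : nat -> bool) (w : idx -> formula -> bool), prop_eval v w phi.

(* The smallest logic containing the axioms and closed under (DIS) and (ARCH).
   In (A3) and (A4) the side condition that the sum is at most 1 is carried by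
   the index [u], whose value is that sum. *)
Inductive SigmaH : formula -> Prop :=
| SigmaH_taut phi : tautology phi -> SigmaH phi
| SigmaH_MP phi psi : SigmaH (Imp phi psi) -> SigmaH phi -> SigmaH psi
| SigmaH_subst sigma phi : SigmaH phi -> SigmaH (subst sigma phi)
| SigmaH_A1 phi : SigmaH (L idx0 phi)
| SigmaH_A2 r : SigmaH (L r Top)
| SigmaH_A3 (r t u : idx) phi psi : val u = val r + val t ->
    SigmaH (Imp (And (L r (And phi psi)) (L t (And phi (Neg psi)))) (L u phi))
| SigmaH_A4 (r s u : idx) phi psi : val u = val r + val s ->
    SigmaH (Imp (And (Neg (L r (And phi psi))) (Neg (L s (And phi (Neg psi)))))
                (Neg (L u phi)))
| SigmaH_A5 (r s : idx) phi : 1 < val r + val s ->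
    SigmaH (Imp (L r phi) (Neg (L s (Neg phi))))
| SigmaH_4p r phi : SigmaH (Imp (L r phi) (L idx1 (L r phi)))
| SigmaH_5p r phi : SigmaH (Imp (Neg (L r phi)) (L idx1 (Neg (L r phi))))
| SigmaH_DIS r phi psi : SigmaH (Iff phi psi) -> SigmaH (Iff (L r phi) (L r psi))
| SigmaH_ARCH (r : idx) gamma phi :
    (forall s : idx, val s < val r -> SigmaH (Imp gamma (L s phi))) ->
    SigmaH (Imp gamma (L r phi)).

Inductive bool_comb_L : formula -> Prop :=
| bool_comb_L_base s phi : bool_comb_L (L s phi)
| bool_comb_L_neg phi : bool_comb_L phi -> bool_comb_L (Neg phi)
| bool_comb_L_and phi psi :
    bool_comb_L phi -> bool_comb_L psi -> bool_comb_L (And phi psi).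

(* Main.v *)
Require Import Defs.
From mathcomp Require Import all_boot all_order all_algebra.
Import Order.TTheory GRing.Theory Num.Theory.
Local Open Scope ring_scope.

(** Semantically, a Boolean combination [psi] of formulas [L s psi'] describes
    the agent's own type, which the agent knows with certainty: by introspection
    [psi] has probability 1 where it holds and probability 0 where it fails.  So
    where [psi] holds both sides of the equivalence hold, and where it fails
    [Or phi psi] and [phi] have the same probability.

    Two syntactic facts carry this argument.  The first, [L_and_certain], is
    that intersecting with a certain event preserves lower bounds on
    probability: [L r phi] and [L idx1 chi] yield [L r (And phi chi)].  The
    second, [introspection], is that [psi -> L idx1 psi] and
    [Neg psi -> L idx1 (Neg psi)] are theorems; it extends the axioms (4p) and
    (5p) through the connectives, the first fact giving the case of
    conjunctions.  If [psi] holds, then [L r (And Top psi)], hence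
    [L r (Or phi psi)], because [L r Top] is an axiom.  If [psi] fails, then
    [L r (Or phi psi)] gives [L r (And (Or phi psi) (Neg psi))], hence
    [L r phi]. *)

Lemma SigmaH_taut_MP phi psi :
  tautology (Imp phi psi) -> SigmaH phi -> SigmaH psi.
Proof. by move=> taut; apply/SigmaH_MP/SigmaH_taut. Qed.

Lemma SigmaH_taut_MP2 phi1 phi2 psi :
  tautology (Imp phi1 (Imp phi2 psi)) ->
  SigmaH phi1 -> SigmaH phi2 -> SigmaH psi.
Proof. by move=> taut h1; apply/SigmaH_MP/(SigmaH_taut_MP _ _ taut). Qed.

Lemma SigmaH_taut_MP3 phi1 phi2 phi3 psi :
  tautology (Imp phi1 (Imp phi2 (Imp phi3 psi))) ->
  SigmaH phi1 -> SigmaH phi2 -> SigmaH phi3 -> SigmaH psi.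
Proof.
by move=> taut h1 h2; apply/SigmaH_MP/(SigmaH_taut_MP2 _ _ _ taut h1 h2).
Qed.

(* Truth tables over the letters, the modal atoms and the metavariables. *)
Ltac tauto_SigmaH :=
  let v := fresh in let w := fresh in
  move=> v w /=; rewrite ?negb_and ?negbK;
  repeat match goal with
  | |- context [v ?p] => case: (v p)
  | |- context [w ?s ?phi] => case: (w s phi)
  | |- context [prop_eval v w ?phi] => case: (prop_eval v w phi)
  end; done.

(** If [phi -> psi] is a theorem, [phi] is equivalent to [And psi phi], so (A3)
    adds the bound [L idx0] for [And psi (Neg phi)] to the bound for [phi]. *)
Lemma L_monotone r phi psi :
  SigmaH (Imp phi psi) -> SigmaH (Imp (L r phi) (L r psi)).
Proof.
move=> phi_psi.
have split_psi : SigmaH (Iff (L r phi) (L r (And psi phi))).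
  apply: SigmaH_DIS; apply: SigmaH_taut_MP phi_psi; tauto_SigmaH.
have add_zero := @SigmaH_A3 r idx0 r psi phi (esym (addr0 (val r))).
apply: SigmaH_taut_MP3 split_psi add_zero (SigmaH_A1 (And psi (Neg phi))).
tauto_SigmaH.
Qed.

(** For [s < r], additivity (A4) splits [phi] along [chi]: were
    [And phi chi] below [s], the part outside [chi] would have probability at
    least [r - s > 0], which (A5) excludes when [chi] is certain.  (ARCH) then
    passes from all [s < r] to [r], where the same splitting would leave the
    vacuous bound 0 outside [chi]. *)
Lemma L_and_certain r phi chi :
  SigmaH (Imp (And (L r phi) (L idx1 chi)) (L r (And phi chi))).
Proof.
apply: SigmaH_ARCH => s lt_sr.
have d_idx : 0 <= val r - val s <= 1.
  rewrite subr_ge0 (ltW lt_sr) lerBlDr /=.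
  case/andP: (valP r) => _ /le_trans; apply.
  by rewrite lerDl; case/andP: (valP s).
pose d : idx := exist _ (val r - val s) d_idx.
have r_split : val r = val s + val d by rewrite /= addrC subrK.
have certain_d : 1 < val idx1 + val d by rewrite /= ltrDl subr_gt0.
have outside : SigmaH (Imp (L d (And phi (Neg chi))) (L d (Neg chi))).
  by apply/L_monotone/SigmaH_taut; tauto_SigmaH.
apply: SigmaH_taut_MP3 outside (@SigmaH_A5 idx1 d chi certain_d)
  (@SigmaH_A4 s d r phi chi r_split).
tauto_SigmaH.
Qed.

(** The two halves must be proved together: negation exchanges them. *)
Lemma introspection psi : bool_comb_L psi ->
  SigmaH (Imp psi (L idx1 psi)) /\ SigmaH (Imp (Neg psi) (L idx1 (Neg psi))).
Proof.
elim=> [s phi | phi _ [pos neg] | phi chi _ [pos1 neg1] _ [pos2 neg2]].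
- by split; [exact: SigmaH_4p | exact: SigmaH_5p].
- split=> //.
  have double_neg : SigmaH (Imp (L idx1 phi) (L idx1 (Neg (Neg phi)))).
    by apply/L_monotone/SigmaH_taut; tauto_SigmaH.
  by apply: SigmaH_taut_MP2 pos double_neg; tauto_SigmaH.
- split.
    apply: SigmaH_taut_MP3 pos1 pos2 (L_and_certain idx1 phi chi).
    tauto_SigmaH.
  have fail1 : SigmaH (Imp (Neg phi) (L idx1 (Neg (And phi chi)))).
    have mono : SigmaH (Imp (L idx1 (Neg phi)) (L idx1 (Neg (And phi chi)))).
      by apply/L_monotone/SigmaH_taut; tauto_SigmaH.
    by apply: SigmaH_taut_MP2 neg1 mono; tauto_SigmaH.
  have fail2 : SigmaH (Imp (Neg chi) (L idx1 (Neg (And phi chi)))).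
    have mono : SigmaH (Imp (L idx1 (Neg chi)) (L idx1 (Neg (And phi chi)))).
      by apply/L_monotone/SigmaH_taut; tauto_SigmaH.
    by apply: SigmaH_taut_MP2 neg2 mono; tauto_SigmaH.
  by apply: SigmaH_taut_MP2 fail1 fail2; tauto_SigmaH.
Qed.

Theorem theorem3p14 (psi : formula) (hpsi : bool_comb_L psi)
    (r : idx) (hr : 0 < val r) (phi : formula) :
  SigmaH (Iff (Or (L r phi) psi) (L r (Or phi psi))).
Proof.
have [pos neg] := introspection psi hpsi.
have phi_case : SigmaH (Imp (L r phi) (L r (Or phi psi))).
  by apply/L_monotone/SigmaH_taut; tauto_SigmaH.
have psi_case : SigmaH (Imp psi (L r (Or phi psi))).
  have top_psi : SigmaH (Imp psi (L r (And Top psi))).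
    apply: SigmaH_taut_MP3 pos (SigmaH_A2 r) (L_and_certain r Top psi).
    tauto_SigmaH.
  have mono : SigmaH (Imp (L r (And Top psi)) (L r (Or phi psi))).
    by apply/L_monotone/SigmaH_taut; tauto_SigmaH.
  by apply: SigmaH_taut_MP2 top_psi mono; tauto_SigmaH.
have converse : SigmaH (Imp (L r (Or phi psi)) (Or (L r phi) psi)).
  have mono : SigmaH (Imp (L r (And (Or phi psi) (Neg psi))) (L r phi)).
    by apply/L_monotone/SigmaH_taut; tauto_SigmaH.
  apply: SigmaH_taut_MP3 neg (L_and_certain r (Or phi psi) (Neg psi)) mono.
  tauto_SigmaH.
by apply: SigmaH_taut_MP3 phi_case psi_case converse; tauto_SigmaH.
Qed.
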